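(* Let $(p,q)$ be a pair of non-zero integers. Then $\pi_{1}(K_{p,q}(0))$ is bi-orderable if and only if it admits no generalized torsion elements.
   Context: Notation: $[g,h]=g^{-1}h^{-1}gh$ and $g^{h}=h^{-1}gh$. A group $F$ is bi-orderable if it admits a total order $<$ such that $g<h$ implies $agb<ahb$ for all $g,h,a,b\in F$. A generalized torsion element of a group $F$ is a non-trivial element $g\in F$ for which there exist a positive integer $n$ and $h_1,\dots,h_n\in F$ with $g^{h_1}g^{h_2}\cdots g^{h_n}=1$. For non-zero integers $p,q$, $K_{p,q}\subset S^3$ denotes the double twist knot of type $(p,q)$: the two-bridge knot with Conway notation $C[2p,2q]$ (continued fraction $2p+\frac{1}{2q}$), with conventions such that $K_{1,1}$ is the figure eight knot and $K_{1,-1}$ is the right-handed trefoil. $K_{p,q}(0)$ denotes the closed 3-manifold obtained from $S^3$ by $0$-surgery along $K_{p,q}$. Its fundamental group has the presentation $$\pi_1(K_{p,q}(0))=\langle a,b,t \mid ta^{p}t^{-1}=b^{-1}a^{p},\ tb^{-q}a^{-1}t^{-1}=b^{-q},\ [b^{q},a^{p}]=1\rangle,$$ where $t$ is a meridian of $K_{p,q}$ and $[b^q,a^p]$ is the canonical longitude. *)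

(* Defs.v *)
From HB Require Import structures.
From mathcomp Require Import all_boot all_order ssralg ssrnum ssrint.
From mathcomp Require Import boolp.

Set Implicit Arguments.
Unset Strict Implicit.
Unset Printing Implicit Defensive.

Local Open Scope group_scope.
Local Open Scope quotient_scope.

(** * Group presentations *)

(* Formal group expressions in the variables [X]. They satisfy no law, but they
   are a [baseGroupType], so that relations can be written with the library
   notations for products, inverses, powers and commutators. *)
Inductive gterm (X : Type) : Type :=
| GVar of X
| GOne
| GMul of gterm X & gterm X
| GInv of gterm X.

Arguments GOne {X}.

HB.instance Definition _ (X : Type) := gen_eqMixin (gterm X).
HB.instance Definition _ (X : Type) := gen_choiceMixin (gterm X).
HB.instance Definition _ (X : Type) := hasMul.Build (gterm X) (@GMul X).
HB.instance Definition _ (X : Type) := hasOne.Build (gterm X) (@GOne X).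
HB.instance Definition _ (X : Type) := hasInv.Build (gterm X) (@GInv X).

(* The pair [(u, v)] in [R] stands for the relation [u = v]. *)
Inductive pres_eq (X : Type) (R : seq (gterm X * gterm X)) :
  gterm X -> gterm X -> Prop :=
| pres_refl u : pres_eq R u u
| pres_sym u v : pres_eq R u v -> pres_eq R v u
| pres_trans u v w : pres_eq R u v -> pres_eq R v w -> pres_eq R u w
| pres_mul u u' v v' :
    pres_eq R u u' -> pres_eq R v v' -> pres_eq R (u * v) (u' * v')
| pres_inv u u' : pres_eq R u u' -> pres_eq R u^-1 u'^-1
| pres_assoc u v w : pres_eq R (u * (v * w)) (u * v * w)
| pres_mul1l u : pres_eq R (1 * u) u
| pres_mul1r u : pres_eq R (u * 1) u
| pres_mulVl u : pres_eq R (u^-1 * u) 1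
| pres_mulVr u : pres_eq R (u * u^-1) 1
| pres_rel u v : (u, v) \in R -> pres_eq R u v.

Section Presented.
Variables (X : Type) (R : seq (gterm X * gterm X)).

Definition pres_eqb (u v : gterm X) : bool := `[< pres_eq R u v >].

Lemma pres_eqb_equiv : equiv_class_of pres_eqb.
Proof.
split=> [u|u v|v u w].
- exact/asboolP/pres_refl.
- by apply/idP/idP => /asboolP ?; apply/asboolP/pres_sym.
- by move=> /asboolP uv /asboolP vw; apply/asboolP/(pres_trans uv).
Qed.

Canonical pres_equiv := EquivRelPack pres_eqb_equiv.

Definition presented := {eq_quot pres_equiv}.

HB.instance Definition _ := Choice.on presented.
HB.instance Definition _ := EqQuotient.on presented.

Lemma presentedP (u v : gterm X) :
  \pi_presented u = \pi_presented v <-> pres_eq R u v.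
Proof. by split=> [/eqmodP/asboolP|?]; last exact/eqmodP/asboolP. Qed.

Definition presented_mul (x y : presented) : presented :=
  \pi_presented (repr x * repr y).
Definition presented_one : presented := \pi_presented 1.
Definition presented_inv (x : presented) : presented :=
  \pi_presented (repr x)^-1.

Lemma presented_repr u : pres_eq R (repr (\pi_presented u)) u.
Proof. by apply/presentedP; rewrite reprK. Qed.

Lemma pi_presented_mul u v :
  presented_mul (\pi_presented u) (\pi_presented v) = \pi_presented (u * v).
Proof. exact/presentedP/pres_mul/presented_repr/presented_repr. Qed.

Lemma pi_presented_inv u :
  presented_inv (\pi_presented u) = \pi_presented u^-1.
Proof. exact/presentedP/pres_inv/presented_repr. Qed.

Lemma presented_mulA : associative presented_mul.
Proof.
elim/quotW=> u; elim/quotW=> v; elim/quotW=> w.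
rewrite (pi_presented_mul v w) (pi_presented_mul u v) !pi_presented_mul.
exact/presentedP/pres_assoc.
Qed.

Lemma presented_mul1l : left_id presented_one presented_mul.
Proof.
elim/quotW=> u; rewrite pi_presented_mul; exact/presentedP/pres_mul1l.
Qed.

Lemma presented_mul1r : right_id presented_one presented_mul.
Proof.
elim/quotW=> u; rewrite pi_presented_mul; exact/presentedP/pres_mul1r.
Qed.

Lemma presented_mulVl :
  left_inverse presented_one presented_inv presented_mul.
Proof.
elim/quotW=> u; rewrite pi_presented_inv pi_presented_mul.
exact/presentedP/pres_mulVl.
Qed.

Lemma presented_mulVr :
  right_inverse presented_one presented_inv presented_mul.
Proof.
elim/quotW=> u; rewrite pi_presented_inv pi_presented_mul.
exact/presentedP/pres_mulVr.
Qed.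

HB.instance Definition _ := isGroup.Build presented
  presented_mulA presented_mul1l presented_mul1r
  presented_mulVl presented_mulVr.

End Presented.

(** * Bi-orders and generalized torsion *)

Definition bi_orderable (F : groupType) : Prop :=
  exists lt : rel F,
    [/\ irreflexive lt,
        transitive lt,
        (forall g h : F, g != h -> lt g h || lt h g)
      & (forall g h a b : F, lt g h -> lt (a * g * b) (a * h * b))].

(* The library's [g ^ h] is the conjugate [h^-1 * (g * h)]. *)
Definition generalized_torsion (F : groupType) (g : F) : Prop :=
  g != 1 /\
  exists n : nat, (0 < n)%N /\
    exists h : 'I_n -> F, \prod_(i < n) (g ^ h i) = 1.

(** * The group of the 0-surgery on a double twist knot *)

Definition expgz (G : baseGroupType) (x : G) (k : int) : G :=
  match k with
  | Posz n => x ^+ n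
  | Negz n => x ^- n.+1
  end.

Variant surgery_gen : Type := gen_a | gen_b | gen_t.

(* The double twist knot K_{p,q} is the two-bridge knot C[2p,2q] (continued
   fraction 2p + 1/(2q)), with conventions such that K_{1,1} is the figure eight
   knot and K_{1,-1} the right-handed trefoil. These are the relations of the
   standard presentation of the fundamental group of the closed 3-manifold
   K_{p,q}(0) obtained by 0-surgery on K_{p,q}: [t] is a meridian, and the
   commutator, killed by the surgery, is the canonical longitude. *)
Definition surgery_rels (p q : int) :
    seq (gterm surgery_gen * gterm surgery_gen) :=
  let a := GVar gen_a in
  let b := GVar gen_b in
  let t := GVar gen_t in
  [:: (t * expgz a p * t^-1, b^-1 * expgz a p);
      (t * expgz b (- q)%R * a^-1 * t^-1, expgz b (- q)%R);
      ([~ expgz b q, expgz a p], 1)].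

Definition pi1_double_twist_surgery (p q : int) : groupType :=
  presented (surgery_rels p q).

(* Main.v *)
Require Import Defs.
From HB Require Import structures.
From mathcomp Require Import all_boot all_order ssralg ssrnum ssrint.
From mathcomp Require Import rat archimedean zmodp boolp realalg ring lra zify.

Set Implicit Arguments.
Unset Strict Implicit.
Unset Printing Implicit Defensive.

Import Order.TTheory GRing.Theory Num.Theory.

Local Open Scope group_scope.
Local Open Scope quotient_scope.

(** Write Gamma(p,q) for the surgery group. A bi-order excludes generalized
    torsion in every group: conjugates of an element above 1 stay above 1, and
    so do their products. Conversely, a generalized torsion element is exhibited
    for all (p,q) except p = q = 1 and p = q = -1, and in these two cases a
    bi-order is constructed.

    Suppose |p| > 1. The relation [b^q, a^p] = 1 makes the commutator [b^q, a] a
    generalized torsion element as soon as it is not trivial, because [y, x^n]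
    is a product of n conjugates of [y, x] ([commg_expgn_prod]). When |q| > 1,
    the commutator [a^p, b] plays the same role. The real point is
    non-triviality. Gamma(p,q) is an HNN extension, with stable letter t, of the
    group H generated by a and b with the single relation [b^q, a^p] = 1, so H
    embeds in it. What is needed of this embedding is proved without normal
    forms: given any group L and alpha, beta in L with [beta^q, alpha^p] = 1,
    the group Gamma(p,q) acts on the set Q^2 x L, with a and b acting on the
    factor L as the left multiplications by alpha and beta
    ([model_surgery_triple]). Commutation of powers of a and b therefore implies
    that of the same powers of alpha and beta ([surgery_commute_detected]), and
    it remains to find a group L in which, say, alpha^p = 1 while alpha does not
    commute with beta^q: alpha cycles one fibre of Z x Z/|p|, and beta
    translates Z ([cycle_translate_not_commute]).

    If |p| = |q| = 1 then Gamma(p,q) is the group of a torus bundle over the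
    circle, with monodromy of trace 1 if q = -p and of trace 3 if q = p. In the
    first case the monodromy has order 6 and its cube is -1, so that a is
    conjugate to its inverse; a is not trivial, as it acts on Q^2 by a
    non-trivial translation ([surgery_a_neq1]). In the second case the monodromy
    has the real eigenvalue phi^2 > 0, for phi the golden ratio, and a linear
    form that is an eigenvector for it identifies Gamma(p,q) with a group of
    increasing affine maps of the line ([affine_surgery_triple]); injectivity is
    the irrationality of phi. Increasing affine maps are bi-ordered by comparing
    their values near +infinity ([affine_bi_orderable]). *)

(** * Integer powers *)

Lemma int_step_ind (P : int -> Prop) :
    P 0%R -> (forall k, P k -> P (k + 1)%R) -> (forall k, P k -> P (k - 1)%R) ->
  forall k, P k.
Proof.
move=> P0 PS PP; elim/int_rect=> [//|n /PS|n /PP].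
  by rewrite -PoszD addn1.
by rewrite -opprD -PoszD addn1.
Qed.

Section IntegerPowers.
Variable G : groupType.
Implicit Types (x y : G) (k : int).

Lemma expgzS x k : expgz x (k + 1)%R = x * expgz x k.
Proof.
case: k => [n|[|n]]; first by rewrite -PoszD addn1 /= expgS.
- by rewrite (_ : (_ + 1)%R = 0%R) //= expg1 mulgV.
- rewrite (_ : (Negz n.+1 + 1)%R = Negz n); last by rewrite !NegzE; lia.
  by rewrite /= (expgSr x n.+1) invgM mulVKg.
Qed.

Lemma expgzP x k : expgz x (k - 1)%R = x^-1 * expgz x k.
Proof. by rewrite -{2}(subrK 1%R k) expgzS mulKg. Qed.

Lemma expgz1 x : expgz x 1%R = x. Proof. by []. Qed.

Lemma expgzN1 x : expgz x (- 1%R)%R = x^-1. Proof. by []. Qed.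

Lemma expgz1g k : expgz (1 : G) k = 1.
Proof. by case: k => n /=; rewrite expg1n ?invg1. Qed.

Lemma expgzD x m n : expgz x (m + n)%R = expgz x m * expgz x n.
Proof.
elim/int_step_ind: m => [|m IH|m IH]; first by rewrite add0r mul1g.
- by rewrite addrAC !expgzS IH mulgA.
- by rewrite addrAC !expgzP IH mulgA.
Qed.

Lemma expgzN x k : expgz x (- k)%R = (expgz x k)^-1.
Proof. by apply/esym/mulg1_eq; rewrite -expgzD subrr. Qed.

Lemma commuteXz x y k : commute x y -> commute x (expgz y k).
Proof. by move=> xy; case: k => n /=; [|apply: commuteV]; apply: commuteX. Qed.

Lemma commuteXz2 x y m n : commute x y -> commute (expgz x m) (expgz y n).
Proof. by move=> xy; apply/commuteXz/commute_sym/commuteXz/commute_sym. Qed.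

Lemma commuteXabsz x y k : commute y (expgz x k) -> commute y (x ^+ `|k|%N).
Proof. by case: k => n //= /commuteV; rewrite invgK. Qed.

Lemma expgz_absz_eq1 x k : x ^+ `|k|%N = 1 -> expgz x k = 1.
Proof. by case: k => n /= ->; rewrite ?invg1. Qed.

Lemma expgzMg x y k :
  commute x y -> expgz (x * y) k = expgz x k * expgz y k.
Proof.
move=> xy; elim/int_step_ind: k => [|k IH|k IH]; first by rewrite mulg1.
  rewrite !expgzS IH -!mulgA; congr (x * _).
  by rewrite !mulgA (commuteXz k (commute_sym xy)).
have xVy : commute (expgz x k) y^-1.
  exact/commuteV/commute_sym/commuteXz/commute_sym.
by rewrite !expgzP IH xy invgM -!mulgA; congr (_ * _); rewrite !mulgA xVy.
Qed.

Lemma expgzM x m n : expgz x (m * n)%R = expgz (expgz x m) n.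
Proof.
elim/int_step_ind: n => [|n IH|n IH]; first by rewrite mulr0.
- by rewrite mulrDr mulr1 (addrC (m * n)%R) expgzS -IH -expgzD.
- by rewrite mulrBr mulr1 (addrC (m * n)%R) expgzP -IH -expgzN -expgzD.
Qed.

Lemma expgz_conjg x y k : expgz x k ^ y = expgz (x ^ y) k.
Proof. by case: k => n; rewrite /expgz ?conjVg conjXg. Qed.

End IntegerPowers.

Lemma gmulfXz (G H : groupType) (f : UMagmaMorphism.type G H) k :
  {morph f : x / expgz x k}.
Proof. by case: k => n x /=; [apply: gmulfXn | rewrite gmulfV gmulfXn]. Qed.

(** * Homomorphisms out of a presented group *)

Section UniversalProperty.
Variables (X : Type) (R : seq (gterm X * gterm X)).

Fixpoint gterm_eval (G : baseGroupType) (f : X -> G) (u : gterm X) : G :=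
  match u with
  | GVar x => f x
  | GOne => 1
  | GMul v w => gterm_eval f v * gterm_eval f w
  | GInv v => (gterm_eval f v)^-1
  end.

Lemma gterm_eval_expgz (G : groupType) (f : X -> G) u k :
  gterm_eval f (expgz u k) = expgz (gterm_eval f u) k.
Proof.
have evalX n : gterm_eval f (u ^+ n) = gterm_eval f u ^+ n.
  by case: n => // n; elim: n => // n IH; rewrite !expgSS -IH.
by case: k => n; rewrite /= -evalX.
Qed.

Lemma presented_piM u v :
  \pi_(presented R) (u * v) = \pi_(presented R) u * \pi_(presented R) v.
Proof. exact/esym/pi_presented_mul. Qed.

Lemma presented_piV u :
  \pi_(presented R) u^-1 = (\pi_(presented R) u)^-1.
Proof. exact/esym/pi_presented_inv. Qed.

Lemma gterm_eval_pi u :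
  gterm_eval (fun x => \pi_(presented R) (GVar x)) u = \pi_(presented R) u.
Proof.
by elim: u => //= [u -> v ->|u ->]; rewrite -?presented_piM -?presented_piV.
Qed.

(** Reaching all elements from 1 by left multiplications only, rather than by
    products of arbitrary elements, is what suits a proof that every element has
    some normal form. *)
Lemma presented_ind (P : presented R -> Prop) :
    P 1 ->
    (forall x g, P g -> P (\pi_(presented R) (GVar x) * g)) ->
    (forall x g, P g -> P ((\pi_(presented R) (GVar x))^-1 * g)) ->
  forall g, P g.
Proof.
move=> P1 PM PV; elim/quotW=> u; rewrite -[\pi_(presented R) u]mulg1.
suff [] : (forall g, P g -> P (\pi_(presented R) u * g)) /\
          (forall g, P g -> P ((\pi_(presented R) u)^-1 * g)).
  by move=> + _; apply.
elim: u => [x||u [uM uV] v [vM vV]|u [uM uV]]; first by split=> g; auto.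
- by split=> g; rewrite ?invg1 mul1g.
- by split=> g Pg; rewrite presented_piM ?invgM -mulgA; auto.
- by split=> g Pg; rewrite presented_piV ?invgK; auto.
Qed.

Section Lift.
Variables (G : groupType) (f : X -> G).
Hypothesis fR : forall u v, (u, v) \in R -> gterm_eval f u = gterm_eval f v.

Lemma pres_eq_eval u v : pres_eq R u v -> gterm_eval f u = gterm_eval f v.
Proof.
elim=> {u v} //=.
- by move=> u v w _ -> _ ->.
- by move=> u u' v v' _ -> _ ->.
- by move=> u u' _ ->.
- by move=> u v w; rewrite mulgA.
- by move=> u; rewrite mul1g.
- by move=> u; rewrite mulg1.
- by move=> u; rewrite mulVg.
- by move=> u; rewrite mulgV.
Qed.

Definition presented_eval (g : presented R) : G := gterm_eval f (repr g).

Lemma presented_eval_pi u :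
  presented_eval (\pi_(presented R) u) = gterm_eval f u.
Proof. exact/pres_eq_eval/presented_repr. Qed.

Lemma presented_evalM : {morph presented_eval : g h / g * h}.
Proof.
elim/quotW=> u; elim/quotW=> v.
by rewrite -presented_piM !presented_eval_pi.
Qed.

Lemma presented_eval1 : presented_eval 1 = 1.
Proof. exact: (presented_eval_pi GOne). Qed.

HB.instance Definition _ :=
  isMultiplicative.Build (presented R) G presented_eval presented_evalM.
HB.instance Definition _ :=
  Multiplicative_isUMagmaMorphism.Build (presented R) G presented_eval
    presented_eval1.

Lemma presented_lift : exists E : UMagmaMorphism.type (presented R) G,
  forall x, E (\pi_(presented R) (GVar x)) = f x.
Proof. by exists presented_eval => x; apply: presented_eval_pi. Qed.

End Lift.
End UniversalProperty.

(** * The group of bijections of a type *)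

(** Storing the inverse makes inversion in the group below a mere exchange of
    fields. *)
Record bijection (T : Type) : Type := Bijection {
  bij_fun :> T -> T;
  bij_inv : T -> T;
  bij_funK : cancel bij_fun bij_inv;
  bij_invK : cancel bij_inv bij_fun }.

Section Bijections.
Variable T : Type.
Implicit Types f g h : bijection T.

Lemma bijectionP f g : f =1 g -> f = g.
Proof.
case: f g => [f f' fK f'K] [g g' gK g'K] /= fg.
have {fg} fg : f = g by apply/funext.
rewrite -{}fg in gK g'K *.
have fg' : f' = g' by apply/funext=> x; rewrite -{1}(g'K x) fK.
rewrite -{}fg' in gK g'K *.
by congr Bijection; apply: Prop_irrelevance.
Qed.

HB.instance Definition _ := gen_eqMixin (bijection T).
HB.instance Definition _ := gen_choiceMixin (bijection T).

Definition bijection_one : bijection T :=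
  @Bijection T id id (fun=> erefl) (fun=> erefl).
Definition bijection_mul f g : bijection T :=
  Bijection (can_comp (@bij_funK T f) (@bij_funK T g))
            (can_comp (@bij_invK T g) (@bij_invK T f)).
Definition bijection_inv f : bijection T :=
  Bijection (@bij_invK T f) (@bij_funK T f).

Lemma bijection_mulA : associative bijection_mul.
Proof. by move=> f g h; apply: bijectionP. Qed.
Lemma bijection_mul1 : left_id bijection_one bijection_mul.
Proof. by move=> f; apply: bijectionP. Qed.
Lemma bijection_mulr1 : right_id bijection_one bijection_mul.
Proof. by move=> f; apply: bijectionP. Qed.
Lemma bijection_mulV : left_inverse bijection_one bijection_inv bijection_mul.
Proof. by move=> f; apply: bijectionP => x; apply: bij_funK. Qed.
Lemma bijection_mulrV : right_inverse bijection_one bijection_inv bijection_mul.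
Proof. by move=> f; apply: bijectionP => x; apply: bij_invK. Qed.

HB.instance Definition _ := isGroup.Build (bijection T) bijection_mulA
  bijection_mul1 bijection_mulr1 bijection_mulV bijection_mulrV.

Lemma bijection1E x : (1 : bijection T) x = x. Proof. by []. Qed.
Lemma bijectionME f g x : (f * g) x = f (g x). Proof. by []. Qed.
Lemma bijectionVE f x y : f y = x -> f^-1 x = y.
Proof. by move=> <-; apply: bij_funK. Qed.

(** Guessing the whole orbit, indexed by all integers, gives negative powers
    without describing the inverse map. *)
Lemma expgz_orbit f (o : int -> T) :
    (forall k, f (o k) = o (k + 1)%R) ->
  forall k, expgz f k (o 0%R) = o k.
Proof.
move=> fo; elim/int_step_ind=> [//|k IH|k IH].
- by rewrite expgzS bijectionME IH.
- by rewrite expgzP bijectionME IH; apply: bijectionVE; rewrite fo subrK.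
Qed.

End Bijections.

(** * The surgery group *)

(** The relations for elements of an arbitrary group, so that they can be both
    extracted from the surgery group and checked in the target of a
    homomorphism. *)
Definition surgery_triple p q (G : groupType) (a b t : G) : Prop :=
  [/\ t * expgz a p * t^-1 = b^-1 * expgz a p,
      t * expgz b (- q)%R * a^-1 * t^-1 = expgz b (- q)%R
    & [~ expgz b q, expgz a p] = 1].

Definition surgery_elt p q (x : surgery_gen) : pi1_double_twist_surgery p q :=
  \pi_(presented (surgery_rels p q)) (GVar x).

Lemma surgery_tripleP p q :
  surgery_triple p q (surgery_elt p q gen_a) (surgery_elt p q gen_b)
    (surgery_elt p q gen_t).
Proof.
have rel u v : (u, v) \in surgery_rels p q ->
  gterm_eval (surgery_elt p q) u = gterm_eval (surgery_elt p q) v.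
  by move=> uv; rewrite !gterm_eval_pi; apply/presentedP/pres_rel.
pose a := GVar gen_a; pose b := GVar gen_b; pose t := GVar gen_t.
split.
- have := rel (t * expgz a p * t^-1) (b^-1 * expgz a p).
  by rewrite /= !gterm_eval_expgz; apply; rewrite !inE eqxx.
- have := rel (t * expgz b (- q)%R * a^-1 * t^-1) (expgz b (- q)%R).
  by rewrite /= !gterm_eval_expgz; apply; rewrite !inE eqxx orbT.
- have := rel [~ expgz b q, expgz a p] 1.
  by rewrite /= !gterm_eval_expgz; apply; rewrite !inE eqxx !orbT.
Qed.

Lemma surgery_lift p q (G : groupType) (a b t : G) :
    surgery_triple p q a b t ->
  exists E : UMagmaMorphism.type (pi1_double_twist_surgery p q) G,
    [/\ E (surgery_elt p q gen_a) = a, E (surgery_elt p q gen_b) = b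
      & E (surgery_elt p q gen_t) = t].
Proof.
case=> r1 r2 r3.
pose f x := match x with gen_a => a | gen_b => b | gen_t => t end.
have fR u v : (u, v) \in surgery_rels p q -> gterm_eval f u = gterm_eval f v.
  by rewrite !inE => /or3P[] /eqP[-> ->] /=; rewrite !gterm_eval_expgz.
have [E Ef] := presented_lift fR.
by exists E; split; apply: Ef.
Qed.

Lemma surgery_ind p q (P : pi1_double_twist_surgery p q -> Prop) :
    P 1 ->
    (forall x g, P g -> P (surgery_elt p q x * g)) ->
    (forall x g, P g -> P ((surgery_elt p q x)^-1 * g)) ->
  forall g, P g.
Proof. exact: presented_ind. Qed.

(** * A space on which the surgery group acts *)

(** In the model below, a and b translate the plane Q^2 by (1/P, 0) and
    (-1/(PQ), 1/Q). Coordinates are chosen so that a^p and a b^q, which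
    generate the subgroup whose conjugate by t is prescribed, are the unit
    translations. Conjugation by t must turn them into b^-1 a^p and b^q, that
    is, into the translations by (1 + 1/(PQ), -1/Q) and (-1/P, 1): these are the
    columns of the matrix. *)
Section MonodromyMatrix.
Variables (F : fieldType) (P Q : F).
Hypotheses (P_neq0 : P != 0%R) (Q_neq0 : Q != 0%R).
Implicit Types x : F * F.
Local Open Scope ring_scope.

Definition monodromy_matrix x : F * F :=
  ((1 + (P * Q)^-1) * x.1 - x.2 / P, x.2 - x.1 / Q).

Definition monodromy_matrix_inv x : F * F :=
  (x.1 + x.2 / P, x.1 / Q + (1 + (P * Q)^-1) * x.2).

Lemma monodromy_matrixK : cancel monodromy_matrix monodromy_matrix_inv.
Proof.
case=> s r; rewrite /monodromy_matrix /monodromy_matrix_inv /=.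
by congr (_, _); field; rewrite ?P_neq0 ?Q_neq0.
Qed.

Lemma monodromy_matrix_invK : cancel monodromy_matrix_inv monodromy_matrix.
Proof.
case=> s r; rewrite /monodromy_matrix /monodromy_matrix_inv /=.
by congr (_, _); field; rewrite ?P_neq0 ?Q_neq0.
Qed.

Lemma monodromy_matrix_add_e1 s r :
  monodromy_matrix (s + 1, r) =
  ((monodromy_matrix (s, r)).1 + 1 + (P * Q)^-1,
   (monodromy_matrix (s, r)).2 - Q^-1).
Proof.
rewrite /monodromy_matrix /=.
by congr (_, _); field; rewrite ?P_neq0 ?Q_neq0.
Qed.

Lemma monodromy_matrix_sub_e2 s r :
  monodromy_matrix (s, r - 1) =
  ((monodromy_matrix (s, r)).1 + P^-1, (monodromy_matrix (s, r)).2 - 1).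
Proof.
rewrite /monodromy_matrix /=.
by congr (_, _); field; rewrite ?P_neq0 ?Q_neq0.
Qed.

End MonodromyMatrix.

Section Model.
Variables (p q : int) (L : groupType) (alpha beta : L).
Hypotheses (p_neq0 : p != 0%R) (q_neq0 : q != 0%R).
Hypothesis comm_ab : commute (expgz beta q) (expgz alpha p).

Definition model : Type := (rat * rat * L)%type.

Definition shift_fun (c d : rat) (g : L) (x : model) : model :=
  ((x.1.1 + c)%R, (x.1.2 + d)%R, g * x.2).

Lemma shift_funK c d g : cancel (shift_fun c d g) (shift_fun (- c) (- d) g^-1).
Proof. by case=> [[s r] l]; rewrite /shift_fun /= !addrK mulKg. Qed.

Lemma shift_funNK c d g : cancel (shift_fun (- c) (- d) g^-1) (shift_fun c d g).
Proof. by case=> [[s r] l]; rewrite /shift_fun /= !subrK mulVKg. Qed.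

Definition shift c d g : bijection model :=
  Bijection (shift_funK c d g) (shift_funNK c d g).

Lemma expgz_shift c d g k x :
  expgz (shift c d g) k x = shift_fun (c *~ k) (d *~ k) (expgz g k) x.
Proof.
pose o (k : int) := shift_fun (c *~ k) (d *~ k) (expgz g k) x.
have o0 : o 0%R = x.
  by case: x @o => [[s r] l]; rewrite /= /shift_fun /= !addr0 mul1g.
rewrite -{1}o0; apply: (expgz_orbit (o := o)) => j.
by rewrite /o /= /shift_fun /= !mulrzDr !addrA expgzS mulgA.
Qed.

Let P : rat := p%:~R.
Let Q : rat := q%:~R.

Let u := expgz alpha p.
Let w := alpha * expgz beta q.
Let u' := beta^-1 * expgz alpha p.
Let w' := expgz beta q.

Let P_neq0 : P != 0%R. Proof. by rewrite intr_eq0. Qed.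
Let Q_neq0 : Q != 0%R. Proof. by rewrite intr_eq0. Qed.

Let comm_uw : commute u w.
Proof.
apply: commuteM; last exact: commute_sym.
exact/commute_sym/commuteXz/commute_refl.
Qed.

Let comm_uw' : commute w' u'.
Proof.
apply: commuteM => //.
exact/commuteV/commute_sym/commuteXz/commute_refl.
Qed.

(** In the fibre over (s, r), the bijection t acts by a left multiplication
    T(s, r) such that T(s + 1, r) = u' T(s, r) u^-1 and
    T(s, r + 1) = w' T(s, r) w^-1. Since u commutes with w and u' with w', these
    conditions are compatible, and T may be chosen freely on the unit square;
    taking it trivial there gives this formula, at the integral parts of s and
    r. *)
Definition twist (m n : int) : L :=
  expgz u' m * expgz w' n * (expgz u m * expgz w n)^-1.

Lemma twist_succ m n : twist (m + 1) n = u' * twist m n * u^-1.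
Proof. by rewrite /twist !expgzS !invgM !mulgA. Qed.

Lemma twist_pred m n : twist m (n - 1) = w'^-1 * twist m n * w.
Proof.
rewrite /twist -!(commuteXz2 _ m comm_uw') !(commuteXz2 m _ comm_uw).
by rewrite !expgzP !invgM !invgK !mulgA.
Qed.

Definition monodromy_fun (x : model) : model :=
  (monodromy_matrix P Q x.1, twist (Num.floor x.1.1) (Num.floor x.1.2) * x.2).

Definition monodromy_inv (x : model) : model :=
  let y := monodromy_matrix_inv P Q x.1 in
  (y, (twist (Num.floor y.1) (Num.floor y.2))^-1 * x.2).

Lemma monodromy_funK : cancel monodromy_fun monodromy_inv.
Proof.
case=> y l; rewrite /monodromy_fun /monodromy_inv.
by rewrite [x in monodromy_matrix_inv _ _ x]/= monodromy_matrixK // mulKg.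
Qed.

Lemma monodromy_invK : cancel monodromy_inv monodromy_fun.
Proof.
case=> y l; rewrite /monodromy_fun /monodromy_inv.
by rewrite [x in monodromy_matrix _ _ x]/= monodromy_matrix_invK // mulVKg.
Qed.

Definition monodromy := Bijection monodromy_funK monodromy_invK.

Let a := shift P^-1 0 alpha.
Let b := shift (- (P * Q)^-1)%R Q^-1 beta.

Let aE k s r l :
  expgz a k (s, r, l) = ((s + k%:~R / P)%R, r, expgz alpha k * l).
Proof.
by rewrite expgz_shift /shift_fun /= mul0rz addr0 -(mulrzl P^-1%R k).
Qed.

Let bE k s r l :
  expgz b k (s, r, l) =
  ((s - k%:~R / (P * Q))%R, (r + k%:~R / Q)%R, expgz beta k * l).
Proof.
rewrite expgz_shift /shift_fun /= mulNrz.
by rewrite -(mulrzl (P * Q)^-1%R k) -(mulrzl Q^-1%R k).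
Qed.

(** The first two relations of the surgery say that t intertwines two actions of
    Z^2 on Q^2 x L; on Q^2 this is how the matrix was chosen, and on L it is the
    functional equation of [twist]. *)
Lemma model_surgery_triple : surgery_triple p q a b monodromy.
Proof.
split.
- suff E : monodromy * expgz a p = b^-1 * expgz a p * monodromy.
    by rewrite E mulgK.
  apply: bijectionP => -[[s r] l].
  rewrite !bijectionME aE divff //.
  apply: (canRL (bij_funK b)).
  rewrite /= /monodromy_fun /= monodromy_matrix_add_e1 //.
  rewrite floorDrz ?rpred1 // floor1 twist_succ.
  case: (monodromy_matrix P Q (s, r)) => s' r'; rewrite aE divff //.
  rewrite /shift_fun /= addrK subrK; congr (_, _).
  by rewrite !mulgA mulgV mul1g mulgVK.
- suff E : monodromy * expgz b (- q)%R * a^-1 = expgz b (- q)%R * monodromy.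
    by rewrite E mulgK.
  apply: bijectionP => -[[s r] l].
  rewrite !bijectionME.
  have -> : a^-1 (s, r, l) = ((s - P^-1)%R, r, alpha^-1 * l).
    by apply: bijectionVE; rewrite /= /shift_fun /= subrK addr0 mulVKg.
  have PQ : ((- q)%:~R / (P * Q) = - P^-1)%R.
    by rewrite rmorphN /= invfM mulrCA mulNr divff // mulrN1.
  have QQ : ((- q)%:~R / Q = -1)%R by rewrite rmorphN /= mulNr divff.
  rewrite bE PQ QQ opprK subrK /= /monodromy_fun /= monodromy_matrix_sub_e2 //.
  have floorN1 : Num.floor (-1 : rat) = (-1)%R by rewrite -mulrN1z intrKfloor.
  rewrite floorDrz ?rpredN1 // floorN1 twist_pred.
  case: (monodromy_matrix P Q (s, r)) => s' r'; rewrite bE PQ QQ opprK.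
  by rewrite expgzN /w !mulgA !mulgK.
- apply/eqP/commgP/bijectionP => -[[s r] l].
  rewrite !bijectionME !(aE, bE) addrAC !mulgA; congr (_, _, _ * _).
  exact: comm_ab.
Qed.

(** This is the trace of the embedding of H in the surgery group that the
    non-triviality of commutators requires. *)
Lemma surgery_commute_detected i j :
    commute (expgz (surgery_elt p q gen_a) i)
            (expgz (surgery_elt p q gen_b) j) ->
  commute (expgz alpha i) (expgz beta j).
Proof.
have [E [Ea Eb _]] := surgery_lift model_surgery_triple.
move=> /(gmulf_commute E); rewrite !gmulfXz Ea Eb => comm_ij.
have /(congr1 snd) : (expgz a i * expgz b j) (0%R, 0%R, 1) =
  (expgz b j * expgz a i) (0%R, 0%R, 1) by rewrite comm_ij.
by rewrite !bijectionME !(aE, bE) /= !mulg1.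
Qed.

Lemma surgery_a_neq1 : surgery_elt p q gen_a != 1.
Proof.
have [E [Ea _ _]] := surgery_lift model_surgery_triple.
apply/eqP=> a1; move: Ea; rewrite a1 gmulf1.
move=> /(congr1 (fun f : bijection model => (f (0%R, 0%R, 1)).1.1))/eqP.
by rewrite /= add0r eq_sym invr_eq0 (negPf P_neq0).
Qed.

End Model.

(** * Generalized torsion *)

(** The identity behind the generalized torsion: the right-hand side is a
    product of conjugates of [y, x], and it is trivial when y commutes with
    x^n. *)
Lemma commg_expgn_prod (G : groupType) (x y : G) n :
  [~ y, x ^+ n] = \prod_(i < n) ([~ y, x] ^ (x ^+ i)).
Proof.
elim: n => [|n IH]; first by rewrite big_ord0 commg1.
have -> : [~ y, x ^+ n.+1] = [~ y, x] * [~ y, x ^+ n] ^ x.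
  by rewrite expgSr /commg /conjg !invgM !mulgA !mulgK.
rewrite big_ord_recl conjg1 IH conjg_prod; congr (_ * _).
by apply: eq_bigr => i _; rewrite -conjgM -expgSr.
Qed.

(** A bi-orderable group has unique roots, hence y commutes with x as soon as it
    commutes with a positive power of x; where this fails, generalized torsion
    appears. *)
Lemma generalized_torsion_commg (G : groupType) (x y : G) n :
  (0 < n)%N -> commute y (x ^+ n) -> ~ commute y x ->
  generalized_torsion [~ y, x].
Proof.
move=> n_gt0 yxn yx; split; first by apply/eqP=> /eqP/commgP.
exists n; split=> //; exists (fun i => x ^+ i).
by rewrite -commg_expgn_prod; apply/eqP/commgP.
Qed.

Lemma generalized_torsion_conjV (G : groupType) (x y : G) :
  x != 1 -> x ^ y = x^-1 -> generalized_torsion x.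
Proof.
move=> x_neq1 xy; split=> //; exists 2; split=> //.
exists (fun i => if i == ord0 then 1 else y).
by rewrite !big_ord_recl big_ord0 /= conjg1 xy mulg1 mulgV.
Qed.

Lemma bi_orderable_no_generalized_torsion (G : groupType) (g : G) :
  bi_orderable G -> ~ generalized_torsion g.
Proof.
case=> lt [ltxx lt_trans lt_total ltM] [g_neq1 [n [n_gt0 [h hg]]]].
have ltJ x y z : lt x y -> lt (x ^ z) (y ^ z).
  by move=> /(ltM _ _ z^-1 z); rewrite !conjgE !mulgA.
have lt_prod (r : rel G) (F : 'I_n -> G) :
    (forall x y z t, r x y -> r (z * x * t) (z * y * t)) -> transitive r ->
    (forall i, r 1 (F i)) -> r 1 (\prod_i F i).
  move=> rM rT; case: n n_gt0 F {h hg} => // m _ F rF.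
  rewrite big_ord_recl.
  elim: m F rF => [|m IH] F rF; first by rewrite big_ord0 mulg1.
  rewrite big_ord_recl; apply: rT (rF ord0) _.
  have := rM _ _ (F ord0) 1 (IH (F \o lift ord0) (fun i => rF _)).
  by rewrite !mulg1.
case/orP: (lt_total _ _ g_neq1) => g1.
- have := lt_prod (fun x y => lt y x) (fun i => g ^ h i).
  rewrite hg ltxx => H; suff: false by []; apply: H => [x y z t||i].
  + exact: ltM.
  + by move=> y x z xy yz; apply: lt_trans yz xy.
  + by have := ltJ _ _ (h i) g1; rewrite conj1g.
- have := lt_prod lt (fun i => g ^ h i).
  rewrite hg ltxx => H; suff: false by []; apply: H => // i.
  by have := ltJ _ _ (h i) g1; rewrite conj1g.
Qed.

(** * A torsion element commuting with no non-trivial power of a translation *)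

(** The bijection [cycle_at0] has order n but moves only the fibre over 0, which
    every non-trivial power of the translation of the base displaces. *)
Section CyclingOneFibre.
Variable n : nat.
Hypothesis n_gt1 : (1 < n)%N.

Definition cycle_fun (c : 'Z_n) (x : int * 'Z_n) : int * 'Z_n :=
  if x.1 == 0%R then (x.1, (x.2 + c)%R) else x.

Lemma cycle_funK c : cancel (cycle_fun c) (cycle_fun (- c)%R).
Proof.
case=> m i; rewrite /cycle_fun /=.
by case: (eqVneq m 0%R) => [->|/negPf m_neq0] /=; rewrite ?m_neq0 ?addrK.
Qed.

Lemma cycle_funNK c : cancel (cycle_fun (- c)%R) (cycle_fun c).
Proof. by rewrite -{2}(opprK c); apply: cycle_funK. Qed.

Definition cycle_at0 : bijection (int * 'Z_n) :=
  Bijection (cycle_funK 1%R) (cycle_funNK 1%R).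

Definition translate_fun (m : int) (x : int * 'Z_n) : int * 'Z_n :=
  ((x.1 + m)%R, x.2).

Lemma translate_funK m : cancel (translate_fun m) (translate_fun (- m)%R).
Proof. by case=> k i; rewrite /translate_fun /= addrK. Qed.

Lemma translate_funNK m : cancel (translate_fun (- m)%R) (translate_fun m).
Proof. by rewrite -{2}(opprK m); apply: translate_funK. Qed.

Definition translate_base : bijection (int * 'Z_n) :=
  Bijection (translate_funK 1%R) (translate_funNK 1%R).

Lemma cycle_at0_order : cycle_at0 ^+ n = 1.
Proof.
have cycleX k x : (cycle_at0 ^+ k) x = cycle_fun k%:R%R x.
  elim: k x => [|k IH] [m i]; first by rewrite /cycle_fun /= addr0; case: ifP.
  rewrite expgS bijectionME IH /= /cycle_fun /=.
  case: (eqVneq m 0%R) => [->|/negPf m_neq0] /=; rewrite ?m_neq0 //.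
  by rewrite -addrA natr1.
apply: bijectionP => -[m i]; rewrite cycleX pchar_Zp // /cycle_fun /= addr0.
by case: ifP.
Qed.

Lemma cycle_translate_not_commute k :
  k != 0%R -> ~ commute (expgz translate_base k) cycle_at0.
Proof.
move=> k_neq0 comm.
have tE m i : expgz translate_base k (m, i) = ((m + k)%R, i).
  have := expgz_orbit (f := translate_base) (o := fun j => ((m + j)%R, i)).
  by rewrite addr0; apply=> j; rewrite /= /translate_fun /= addrA.
have := congr1 (fun f : bijection _ => (f (0%R, 0%R)).2) comm.
rewrite /= tE add0r /cycle_fun /= tE (negPf k_neq0) /= add0r => /eqP.
by rewrite oner_eq0.
Qed.

End CyclingOneFibre.

Lemma surgery_generalized_torsion_p p q :
    p != 0%R -> q != 0%R -> (1 < `|p|)%N ->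
  exists g : pi1_double_twist_surgery p q, generalized_torsion g.
Proof.
move=> p_neq0 q_neq0 p_gt1.
set a := surgery_elt p q gen_a; set b := surgery_elt p q gen_b.
have [_ _ /eqP/commgP/commuteXabsz bqap] := surgery_tripleP p q.
exists [~ expgz b q, a]; apply: generalized_torsion_commg bqap _ => [|bqa].
  exact: ltnW.
pose cyc := cycle_at0 `|p|%N; pose tr := translate_base `|p|%N.
have cycp : expgz cyc p = 1 by exact/expgz_absz_eq1/cycle_at0_order.
apply: (@cycle_translate_not_commute _ q) => //; apply: commute_sym.
apply: (@surgery_commute_detected p q _ cyc tr _ _ _ 1 q) => //.
by rewrite cycp; apply: commute1.
Qed.

Lemma surgery_generalized_torsion_q p q :
    p != 0%R -> q != 0%R -> (1 < `|q|)%N ->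
  exists g : pi1_double_twist_surgery p q, generalized_torsion g.
Proof.
move=> p_neq0 q_neq0 q_gt1.
set a := surgery_elt p q gen_a; set b := surgery_elt p q gen_b.
have [_ _ /eqP/commgP/commute_sym/commuteXabsz bqap] := surgery_tripleP p q.
exists [~ expgz a p, b]; apply: generalized_torsion_commg bqap _ => [|apb].
  exact: ltnW.
pose cyc := cycle_at0 `|q|%N; pose tr := translate_base `|q|%N.
have cycq : expgz cyc q = 1 by exact/expgz_absz_eq1/cycle_at0_order.
apply: (@cycle_translate_not_commute _ p) => //.
apply: (@surgery_commute_detected p q _ tr cyc _ _ _ p 1) => //.
by rewrite cycq; apply/commute_sym/commute1.
Qed.

(** On the abelian group generated by a and b, conjugation by s acts through a
    matrix of trace 1 and determinant 1, whose characteristic polynomial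
    X^2 - X + 1 divides X^3 + 1. *)
Lemma conjg_cube_inv (G : groupType) (a b s : G) :
  commute a b -> a ^ s = b^-1 * a -> b ^ s = a -> a ^ (s ^+ 3) = a^-1.
Proof.
move=> ab asE bsE; rewrite !expgS expg0 mulg1 !conjgM.
have ass : (a ^ s) ^ s = b^-1.
  by rewrite asE conjMg conjVg asE bsE -(commuteV ab) mulKg.
by rewrite ass conjVg bsE.
Qed.

Lemma surgery_generalized_torsion_opp p q :
    `|p|%N = 1%N -> q = (- p)%R ->
  exists g : pi1_double_twist_surgery p q, generalized_torsion g.
Proof.
move=> p1 ->.
have p_neq0 : p != 0%R by rewrite -absz_gt0 p1.
have a_neq1 : surgery_elt p (- p) gen_a != 1.
  apply: (@surgery_a_neq1 p (- p)%R (bijection unit) 1 1) => //.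
    by rewrite oppr_eq0.
  by rewrite !expgz1g.
exists (surgery_elt p (- p) gen_a).
have [] := surgery_tripleP p (- p)%R; rewrite opprK; move: a_neq1.
set a := surgery_elt _ _ gen_a; set b := surgery_elt _ _ gen_b.
set t := surgery_elt _ _ gen_t; move: a b t.
have conjE (G : groupType) (x y : G) : y * x * y^-1 = x ^ y^-1.
  by rewrite conjgE invgK mulgA.
have [->|->] : p = 1%R \/ p = (-1)%R by lia.
- move=> a b t a_neq1; rewrite !expgz1 expgzN1 -(mulgA t b) !conjE.
  move=> asE bsE /eqP/commgP/commute_sym/commuteV; rewrite invgK => comm_ab.
  apply: generalized_torsion_conjV a_neq1 (conjg_cube_inv comm_ab asE _).
  by rewrite -(mulgVK a b) conjMg bsE asE mulVKg.
- move=> a b t a_neq1; rewrite !expgz1 !expgzN1 -(mulgA t b^-1) !conjE conjVg.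
  move=> /(canRL invgK); rewrite invgM !invgK => asE bsE.
  move=> /eqP/commgP/commute_sym/commuteV comm_aVbV.
  have comm_abV : commute a b^-1.
    by apply/commute_sym; rewrite -(invgK a); apply/commuteV/commute_sym.
  apply: generalized_torsion_conjV a_neq1
    (@conjg_cube_inv _ _ _ t^-1 comm_abV _ _).
    by rewrite asE -(commuteV comm_abV) invgK.
  by rewrite -(mulgVK a b^-1) conjMg bsE asE mulgA -comm_abV mulgVK.
Qed.

(** * Groups of increasing affine maps *)

Section Affine.
Variable F : realFieldType.
Local Open Scope ring_scope.

Section AffineMap.
Variables (m c : F).
Hypothesis m_neq0 : m != 0.

Let fK : cancel (fun x => m * x + c) (fun x => m^-1 * (x - c)).
Proof. by move=> x; rewrite addrK mulKf. Qed.

Let fVK : cancel (fun x => m^-1 * (x - c)) (fun x => m * x + c).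
Proof. by move=> x; rewrite mulVKf // subrK. Qed.

Definition affine_map : bijection F := Bijection fK fVK.

End AffineMap.

Definition increasing_affine (f : bijection F) : Prop :=
  exists m c, 0 < m /\ forall x, f x = m * x + c.

Lemma increasing_affine1 : increasing_affine 1%g.
Proof. by exists 1, 0; split=> // x; rewrite mul1r addr0. Qed.

Lemma increasing_affineM f g :
  increasing_affine f -> increasing_affine g -> increasing_affine (f * g)%g.
Proof.
move=> [m [c [m_gt0 fE]]] [n [d [n_gt0 gE]]].
exists (m * n), (m * d + c); split=> [|x]; first exact: mulr_gt0.
by rewrite bijectionME gE fE mulrDr mulrA addrA.
Qed.

Lemma increasing_affineV f : increasing_affine f -> increasing_affine f^-1%g.
Proof.
move=> [m [c [m_gt0 fE]]]; have m_neq0 := lt0r_neq0 m_gt0.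
exists m^-1, (- (m^-1 * c)); split=> [|x]; first by rewrite invr_gt0.
by apply: bijectionVE; rewrite fE -mulrBr mulVKf // subrK.
Qed.

(** The order compares the values near +infinity. Multiplying on the left
    composes with an increasing map, and multiplying on the right substitutes a
    map tending to +infinity, so both preserve it. It is total because two
    distinct affine maps cross at most once. *)
Lemma affine_bi_orderable (G : groupType)
    (E : UMagmaMorphism.type G (bijection F)) :
    injective E -> (forall g, increasing_affine (E g)) -> bi_orderable G.
Proof.
move=> E_inj E_aff.
exists (fun g h => `[< exists B, forall x, B < x -> E g x < E h x >]); split.
- move=> g; apply/negP=> /asboolP[B /(_ (B + 1))].
  by rewrite ltrDl ltr01 ltxx => /(_ isT).
- move=> h g k /asboolP[B gh] /asboolP[C hk]; apply/asboolP.
  exists (Num.max B C) => x; rewrite gt_max => /andP[Bx Cx].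
  exact: lt_trans (gh x Bx) (hk x Cx).
- have slope_lt g h m n c d : m < n -> (forall x, E g x = m * x + c) ->
    (forall x, E h x = n * x + d) ->
    `[< exists B, forall x, B < x -> E g x < E h x >].
    move=> mn gE hE; apply/asboolP; exists ((c - d) / (n - m)) => x.
    by rewrite ltr_pdivrMr ?subr_gt0 // gE hE; lra.
  have intercept_lt g h m c d : c < d -> (forall x, E g x = m * x + c) ->
    (forall x, E h x = m * x + d) ->
    `[< exists B, forall x, B < x -> E g x < E h x >].
    by move=> cd gE hE; apply/asboolP; exists 0 => x _; rewrite gE hE ltrD2l.
  move=> g h /eqP gh; apply/orP.
  have [m [c [_ gE]]] := E_aff g; have [n [d [_ hE]]] := E_aff h.
  case: (ltgtP m n) => [mn|nm|mn]; [by left; eauto|by right; eauto|].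
  rewrite -{}mn in hE.
  case: (ltgtP c d) => [cd|dc|cd]; [by left; eauto|by right; eauto|].
  by case: gh; apply/E_inj/bijectionP => x; rewrite gE hE cd.
- move=> g h a b /asboolP[B gh]; apply/asboolP.
  have [m [c [m_gt0 aE]]] := E_aff a; have [n [d [n_gt0 bE]]] := E_aff b.
  exists ((B - d) / n) => x; rewrite ltr_pdivrMr // => Bx.
  rewrite !gmulfM !bijectionME !aE ltrD2r ltr_pM2l //; apply: gh.
  by rewrite bE; lra.
Qed.

End Affine.

(** * The golden ratio *)

Section GoldenRatio.
Variable F : rcfType.
Local Open Scope ring_scope.

Definition golden : F := (1 + Num.sqrt 5) / 2.

Lemma golden_gt1 : 1 < golden.
Proof.
have : 1 < Num.sqrt (5 : F) by rewrite -[X in X < _]sqrtr1 ltr_sqrt; lra.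
by rewrite /golden; lra.
Qed.

Lemma goldenE : golden ^+ 2 = golden + 1.
Proof.
have sqrt5 : Num.sqrt (5 : F) ^+ 2 = 5 by rewrite sqr_sqrtr //; lra.
by rewrite /golden; field: sqrt5.
Qed.

(** If i + j phi = 0 then (2i + j)^2 = 5 j^2, and the 5-adic valuations of the
    two sides have different parities unless j = 0. *)
Lemma golden_independent (i j : int) :
  i%:~R + j%:~R * golden = 0 -> i = 0 /\ j = 0.
Proof.
move=> ij0.
have sqrt5 : Num.sqrt (5 : F) ^+ 2 = 5 by rewrite sqr_sqrtr //; lra.
have sqF : ((2 * i + j)%:~R : F) ^+ 2 = (5 * j ^+ 2)%:~R.
  have : (2 * i + j)%:~R = - (j%:~R * Num.sqrt 5) :> F.
    by move: ij0; rewrite /golden !(rmorphD, rmorphM) /=; lra.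
  by move=> ->; rewrite sqrrN exprMn sqrt5 !(rmorphM, rmorphXn) /= mulrC.
have sqZ : (2 * i + j) ^+ 2 = 5 * j ^+ 2.
  by apply: (@intr_inj F); rewrite rmorphXn.
have j0 : j = 0.
  apply/eqP; apply: contraT => j_neq0.
  have sqN : (`|(2 * i + j)%R| ^ 2 = 5 * `|j| ^ 2)%N.
    by rewrite -!abszX sqZ abszM abszX.
  have j_gt0 : (0 < `|j|)%N by rewrite absz_gt0.
  have := congr1 (fun n => odd (logn 5 n)) sqN.
  by rewrite lognM ?expn_gt0 ?j_gt0 // !lognX oddD !oddM.
by move: sqZ; rewrite j0; lia.
Qed.

End GoldenRatio.

(** * The torus bundle with monodromy of trace 3 *)

Section NormalForm.
Variables (G : groupType) (a b t : G).
Hypotheses (comm_ab : commute a b) (taE : a ^ t^-1 = a * b)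
           (tbE : b ^ t^-1 = a * b * b).

Definition normal_form i j k : G := expgz a i * expgz b j * expgz t k.

Lemma normal_form_mula n i j k :
  expgz a n * normal_form i j k = normal_form (n + i)%R j k.
Proof. by rewrite /normal_form expgzD !mulgA. Qed.

Lemma normal_form_mulb n i j k :
  expgz b n * normal_form i j k = normal_form i (n + j)%R k.
Proof.
by rewrite /normal_form expgzD !mulgA (commuteXz2 n i (commute_sym comm_ab)).
Qed.

Lemma conj_normal_form i j :
  (expgz a i * expgz b j) ^ t^-1 =
  expgz a (i + j)%R * expgz b (i + j + j)%R.
Proof.
have comm_ab_b : commute (a * b) b.
  by apply/commute_sym/commuteM; [exact: commute_sym|exact: commute_refl].
rewrite conjMg !expgz_conjg taE tbE (expgzMg j comm_ab_b) mulgA -expgzD.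
by rewrite expgzMg // -mulgA -expgzD.
Qed.

Lemma normal_form_mult i j k :
  t * normal_form i j k = normal_form (i + j)%R (i + j + j)%R (k + 1)%R.
Proof.
rewrite /normal_form -conj_normal_form expgzS mulgA conjgE invgK.
by rewrite !mulgA mulgVK.
Qed.

(** The inverse of (i, j) |-> (i + j, i + 2j). *)
Lemma normal_form_mulVt i j k :
  t^-1 * normal_form i j k = normal_form (i + i - j)%R (j - i)%R (k - 1)%R.
Proof.
apply: (mulgI t); rewrite mulVKg normal_form_mult.
by congr normal_form; lia.
Qed.

End NormalForm.

(** Passing from b to b^-e brings both cases e = 1 and e = -1 to the monodromy
    a |-> a c, c |-> a c^2. *)
Lemma unit_surgery_triple (G : groupType) (e : int) (a b t : G) :
    `|e|%N = 1%N -> surgery_triple e e a b t ->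
  let c := expgz b (- e)%R in
  [/\ commute a c, a ^ t^-1 = a * c & c ^ t^-1 = a * c * c].
Proof.
move=> e1 [].
have conjE (x y : G) : y * x * y^-1 = x ^ y^-1 by rewrite conjgE invgK mulgA.
have [->|->] : e = 1%R \/ e = (-1)%R by lia.
- rewrite !expgz1 !expgzN1 -(mulgA t b^-1) !conjE => aE bE.
  move=> /eqP/commgP/commute_sym/commuteV comm_ab.
  split=> //; first by rewrite aE comm_ab.
  by rewrite -[in LHS](mulgVK a b^-1) conjMg bE aE -comm_ab mulgA -comm_ab.
- rewrite !opprK !expgz1 !expgzN1 -(mulgA t b) !conjE conjVg.
  move=> /(canRL invgK); rewrite invgM !invgK => aE bE.
  move=> /eqP/commgP/commute_sym/commuteV; rewrite invgK => comm_VaVb.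
  have comm_ab : commute a b.
    by rewrite -(invgK a); apply/commute_sym/commuteV/commute_sym.
  split=> //.
  by rewrite -[in LHS](mulgVK a b) conjMg bE aE mulgA -comm_ab.
Qed.

Section UnitParameters.
Variable e : int.
Hypothesis e_unit : `|e|%N = 1%N.

Let Gamma := pi1_double_twist_surgery e e.
Let a : Gamma := surgery_elt e e gen_a.
Let b : Gamma := expgz (surgery_elt e e gen_b) (- e)%R.
Let t : Gamma := surgery_elt e e gen_t.

Lemma unit_surgery_normal_form (g : Gamma) :
  exists i j k, g = normal_form a b t i j k.
Proof.
have [comm_ab taE tbE] := unit_surgery_triple e_unit (surgery_tripleP e e).
rewrite -/a -/t -/b in comm_ab taE tbE.
have gen_bE : surgery_elt e e gen_b = expgz b (- e)%R.
  by rewrite /b -expgzM (_ : - e * - e = 1)%R ?expgz1 //; nia.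
elim/surgery_ind: g => [|x g [i [j [k ->]]]|x g [i [j [k ->]]]].
- by exists 0%R, 0%R, 0%R; rewrite /normal_form !mulg1.
- case: x; rewrite -?/a -?/t ?gen_bE.
  + by rewrite -[a in a * _]expgz1 normal_form_mula; eauto.
  + by rewrite normal_form_mulb //; eauto.
  + by rewrite normal_form_mult //; eauto.
- case: x; rewrite -?/a -?/t ?gen_bE.
  + by rewrite -[a^-1]expgzN1 normal_form_mula; eauto.
  + by rewrite -[X in X * _]expgzN normal_form_mulb //; eauto.
  + by rewrite normal_form_mulVt //; eauto.
Qed.

Local Notation F := realalg.

Let one_neq0 : (1 != 0 :> F)%R. Proof. exact: oner_neq0. Qed.
Let golden2_neq0 : (golden F ^+ 2)%R != 0%R.
Proof. by rewrite expf_neq0 // gt_eqF // (lt_trans ltr01 (golden_gt1 F)). Qed.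

(* The linear form (i, j) |-> i + j phi is multiplied by phi^2 under the
   monodromy (i, j) |-> (i + j, i + 2j). *)
Let A : bijection F := affine_map 1%R one_neq0.
Let B : bijection F := affine_map (- (e%:~R * golden F))%R one_neq0.
Let T : bijection F := affine_map 0%R golden2_neq0.

Let expA k x : expgz A k x = (x + k%:~R)%R.
Proof.
rewrite -{1}[x]addr0.
apply: (expgz_orbit (o := fun k : int => x + k%:~R)%R) => j.
by rewrite /= mul1r rmorphD /= addrA.
Qed.

Let expB k x : expgz B k x = (x - k%:~R * (e%:~R * golden F))%R.
Proof.
rewrite -{1}[x]subr0 -(mul0r (e%:~R * golden F)%R).
apply: (expgz_orbit
  (o := fun k : int => x - k%:~R * (e%:~R * golden F))%R) => j.
by rewrite /= mul1r rmorphD /= mulrDl mul1r opprD addrA.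
Qed.

Let expT k x : expgz T k x = ((golden F ^+ 2) ^ k * x)%R.
Proof.
rewrite -{1}[x]mul1r.
apply: (expgz_orbit (o := fun k : int => (golden F ^+ 2) ^ k * x)%R) => j.
by rewrite /= addr0 addrC expfzDr // expr1z mulrA.
Qed.

Let e_sq : (e * e = 1)%R. Proof. by nia. Qed.

Let e_sqF : (e%:~R * e%:~R = 1 :> F)%R.
Proof. by rewrite -rmorphM /= e_sq. Qed.

Lemma affine_surgery_triple : surgery_triple e e A B T.
Proof.
have g2 := goldenE F.
split.
- suff E : T * expgz A e = B^-1 * expgz A e * T by rewrite E mulgK.
  apply: bijectionP => x; rewrite -(expgzN1 B) !bijectionME expA expB expA /=.
  by rewrite !addr0; ring: g2.
- suff E : T * expgz B (- e)%R * A^-1 = expgz B (- e)%R * T by rewrite E mulgK.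
  apply: bijectionP => x; rewrite -(expgzN1 A) !bijectionME !(expA, expB) /=.
  by rewrite !addr0 rmorphN; ring: g2 e_sqF.
- apply/eqP/commgP/commuteXz2/bijectionP => x.
  by rewrite !bijectionME /= !mul1r addrAC.
Qed.

Lemma unit_surgery_bi_orderable : bi_orderable Gamma.
Proof.
have [E [Ea Eb Et]] := surgery_lift affine_surgery_triple.
have g_gt1 := golden_gt1 F.
apply: (affine_bi_orderable (E := E)).
- apply: gmulf_inj => g; have [i [j [k ->]]] := unit_surgery_normal_form g.
  rewrite /normal_form /b !gmulfM !gmulfXz Ea Eb Et => E1.
  (* 0 is fixed by T, so only the translation part remains there. *)
  have ij0 : (i%:~R + j%:~R * golden F = 0)%R.
    have := congr1 (fun f : bijection F => f 0%R) E1.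
    rewrite !bijectionME expT -expgzM expB expA bijection1E mulr0 sub0r.
    rewrite mulrA -rmorphM mulrAC mulNr e_sq mulN1r rmorphN mulNr opprK.
    by rewrite addrC.
  have [i0 j0] := golden_independent ij0; rewrite i0 j0 !mul1g in E1 *.
  have := congr1 (fun f : bijection F => f 1%R) E1.
  rewrite expT bijection1E mulr1 => /eqP.
  rewrite pexprz_eq1 ?exprn_ge0 ?(ltW (lt_trans ltr01 g_gt1)) //.
  by case/orP=> [/eqP->//|]; rewrite gt_eqF // exprn_egt1.
- have gen_aff x : increasing_affine (E (surgery_elt e e x)).
    case: x; rewrite ?Ea ?Eb ?Et.
    + by exists 1%R, 1%R.
    + by exists 1%R, (- (e%:~R * golden F))%R.
    + exists (golden F ^+ 2)%R, 0%R; split=> //.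
      by rewrite exprn_gt0 // (lt_trans ltr01).
  elim/surgery_ind=> [|x g Eg|x g Eg].
  + by rewrite gmulf1; apply: increasing_affine1.
  + by rewrite gmulfM; exact: increasing_affineM (gen_aff x) Eg.
  + rewrite gmulfM gmulfV; apply: increasing_affineM Eg.
    exact: increasing_affineV (gen_aff x).
Qed.

End UnitParameters.

Theorem theorem1p3 (p q : int) (hp : p <> 0%R) (hq : q <> 0%R) :
  bi_orderable (pi1_double_twist_surgery p q) <->
  ~ (exists g : pi1_double_twist_surgery p q, generalized_torsion g).
Proof.
have p_neq0 : p != 0%R by apply/eqP.
have q_neq0 : q != 0%R by apply/eqP.
split=> [ord [g gt]|no_gt].
  exact: bi_orderable_no_generalized_torsion ord gt.
have [p_gt1|p_le1] := ltnP 1 `|p|%N.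
  by case: no_gt; apply: surgery_generalized_torsion_p.
have [q_gt1|q_le1] := ltnP 1 `|q|%N.
  by case: no_gt; apply: surgery_generalized_torsion_q.
have p1 : `|p|%N = 1%N by lia.
have [->|qNp] : q = p \/ q = (- p)%R by lia.
  exact: unit_surgery_bi_orderable.
by case: no_gt; apply: surgery_generalized_torsion_opp.
Qed.
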